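(* There is a Quillen model structure on $\mathrm{NSet}$ with (a) weak equivalences $\mathcal{W}$ given by the Acyclic NSet maps, (b) fibrations $\mathcal{F}$ given by the Surjecting NSet maps, (c) cofibrations $\mathcal{C}={}^\dagger\underline{\mathcal{F}}$, where $\underline{\mathcal{F}}=\mathcal{W}\cap\mathcal{F}$. Moreover, the acyclic cofibrations $\underline{\mathcal{C}}=\mathcal{C}\cap\mathcal{W}$ are given by the Whiskering NSet maps.
   Context: An N-set is a pair $(S,\sigma)$ with $S$ a set and $\sigma:S\to S$ a function; a map of N-sets is a function commuting with the $\sigma$'s; this is the category $\mathrm{NSet}$. For a map $f:(S,\sigma)\to(T,\sigma)$: - $f$ is Acyclic when $C_n(f):C_n(S,\sigma)\to C_n(T,\sigma)$ is a bijection for every $n>0$, where $C_n(S,\sigma)=\{x\in S:\sigma^n(x)=x\}$. - $f$ is Surjecting when $f:\sigma^{-1}(x)\to\sigma^{-1}(f(x))$ is a surjection for every $x\in S$. - $f$ is Whiskering when $f$ is injective and for every $x\in T$ with $x\notin f(S)$ there is a natural number $n$ with $\sigma^n(x)\in f(S)$. $\ell\dagger r$ means every commutative square with left side $\ell$ and right side $r$ has a diagonal filler; $\mathcal{F}^\dagger=\{r:f\dagger r\ \forall f\in\mathcal{F}\}$, ${}^\dagger\mathcal{F}=\{\ell:\ell\dagger f\ \forall f\in\mathcal{F}\}$. A weak factorization system is a pair $(\mathcal{L},\mathcal{R})$ with $\mathcal{L}^\dagger=\mathcal{R}$, $\mathcal{L}={}^\dagger\mathcal{R}$, such that every morphism factors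 as $r\circ\ell$ with $\ell\in\mathcal{L}$, $r\in\mathcal{R}$. A model structure on a category with finite limits and colimits is a triple $(\mathcal{C},\mathcal{W},\mathcal{F})$ of classes of morphisms (cofibrations, weak equivalences, fibrations) such that (1) if two of $a,b,a\circ b$ are in $\mathcal{W}$ so is the third; (2) $(\mathcal{C}\cap\mathcal{W},\mathcal{F})$ is a weak factorization system; (3) $(\mathcal{C},\mathcal{W}\cap\mathcal{F})$ is a weak factorization system. *)

(* Defs.v *)
From mathcomp Require Import all_boot.
From mathcomp Require Import boolp classical_sets functions cardinality.
Set Implicit Arguments.
Unset Strict Implicit.
Unset Printing Implicit Defensive.
Local Open Scope classical_set_scope.

Record Category := MkCategory {
  Ob :> Type;
  Hom : Ob -> Ob -> Type;
  idm : forall X, Hom X X;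
  comp : forall X Y Z, Hom Y Z -> Hom X Y -> Hom X Z;
  comp_idl : forall X Y (f : Hom X Y), comp (idm Y) f = f;
  comp_idr : forall X Y (f : Hom X Y), comp f (idm X) = f;
  comp_assoc : forall X Y Z W (h : Hom Z W) (g : Hom Y Z) (f : Hom X Y),
    comp h (comp g f) = comp (comp h g) f }.

Arguments Hom {c} X Y.
Arguments idm {c} X.
Arguments comp {c X Y Z} g f.

Declare Scope cat_scope.
Open Scope cat_scope.
Notation "g ∘ f" := (comp g f) (at level 40, left associativity) : cat_scope.

Record Functor (J C : Category) := MkFunctor {
  fob :> J -> C;
  fmap : forall i j : J, Hom i j -> Hom (fob i) (fob j);
  fmap_id : forall i : J, fmap (idm i) = idm (fob i);
  fmap_comp : forall (i j k : J) (g : Hom j k) (f : Hom i j),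
    fmap (g ∘ f) = fmap g ∘ fmap f }.

Arguments fmap {J C} f {i j} a : rename.

Definition IsFiniteCategory (J : Category) : Prop :=
  finite_set [set: Ob J] /\ forall i j : J, finite_set [set: Hom i j].

Definition IsCone (J C : Category) (D : Functor J C) (L : C)
    (p : forall j : J, Hom L (D j)) : Prop :=
  forall (i j : J) (a : Hom i j), fmap D a ∘ p i = p j.

Definition IsLimit (J C : Category) (D : Functor J C) (L : C)
    (p : forall j : J, Hom L (D j)) : Prop :=
  IsCone p /\
  forall (X : C) (q : forall j : J, Hom X (D j)), IsCone q ->
    exists! u : Hom X L, forall j : J, p j ∘ u = q j.

Definition IsCocone (J C : Category) (D : Functor J C) (L : C)
    (p : forall j : J, Hom (D j) L) : Prop :=
  forall (i j : J) (a : Hom i j), p j ∘ fmap D a = p i.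

Definition IsColimit (J C : Category) (D : Functor J C) (L : C)
    (p : forall j : J, Hom (D j) L) : Prop :=
  IsCocone p /\
  forall (X : C) (q : forall j : J, Hom (D j) X), IsCocone q ->
    exists! u : Hom L X, forall j : J, u ∘ p j = q j.

Definition HasFiniteLimits (C : Category) : Prop :=
  forall (J : Category) (D : Functor J C), IsFiniteCategory J ->
    exists (L : C) (p : forall j : J, Hom L (D j)), IsLimit p.

Definition HasFiniteColimits (C : Category) : Prop :=
  forall (J : Category) (D : Functor J C), IsFiniteCategory J ->
    exists (L : C) (p : forall j : J, Hom (D j) L), IsColimit p.

Definition MorClass (C : Category) := forall X Y : C, Hom X Y -> Prop.

Definition mcap (C : Category) (P Q : MorClass C) : MorClass C :=
  fun X Y f => P X Y f /\ Q X Y f.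

Definition mceq (C : Category) (P Q : MorClass C) : Prop :=
  forall (X Y : C) (f : Hom X Y), P X Y f <-> Q X Y f.

Definition Lifts (C : Category) (A B X Y : C)
    (l : Hom A B) (r : Hom X Y) : Prop :=
  forall (u : Hom A X) (v : Hom B Y), r ∘ u = v ∘ l ->
    exists h : Hom B X, h ∘ l = u /\ r ∘ h = v.

Definition rlp (C : Category) (P : MorClass C) : MorClass C :=
  fun X Y r => forall (A B : C) (f : Hom A B), P A B f -> Lifts f r.

Definition llp (C : Category) (P : MorClass C) : MorClass C :=
  fun A B l => forall (X Y : C) (f : Hom X Y), P X Y f -> Lifts l f.

Record IsWFS (C : Category) (L R : MorClass C) : Prop := MkWFS {
  wfs_right : mceq (rlp L) R;
  wfs_left : mceq L (llp R);
  wfs_factor : forall (X Y : C) (f : Hom X Y),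
    exists (Z : C) (l : Hom X Z) (r : Hom Z Y),
      [/\ L X Z l, R Z Y r & f = r ∘ l] }.

Definition TwoOutOfThree (C : Category) (W : MorClass C) : Prop :=
  forall (X Y Z : C) (a : Hom Y Z) (b : Hom X Y),
    [/\ W Y Z a -> W X Y b -> W X Z (a ∘ b),
        W Y Z a -> W X Z (a ∘ b) -> W X Y b &
        W X Y b -> W X Z (a ∘ b) -> W Y Z a].

Record IsModelStructure (C : Category) (Cof W Fib : MorClass C) : Prop :=
  MkModelStructure {
    ms_limits : HasFiniteLimits C;
    ms_colimits : HasFiniteColimits C;
    ms_2of3 : TwoOutOfThree W;
    ms_acof_fib : IsWFS (mcap Cof W) Fib;
    ms_cof_afib : IsWFS Cof (mcap W Fib) }.

Record NSetOb := MkNSet { carrier :> Type; sigma : carrier -> carrier }.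

Arguments sigma {n} x : rename.

Record NSetHom (S T : NSetOb) := MkNSetHom {
  nfun :> S -> T;
  nfun_sigma : forall x : S, nfun (sigma x) = sigma (nfun x) }.

Lemma NSetHom_eq (S T : NSetOb) (f g : NSetHom S T) : f =1 g -> f = g.
Proof.
case: f g => [f Hf] [g Hg] /= /funext efg; case: g / efg Hg => Hg.
by rewrite (Prop_irrelevance Hf Hg).
Qed.

Definition NSet_id (S : NSetOb) : NSetHom S S :=
  @MkNSetHom S S (fun x => x) (fun=> erefl).

Lemma NSet_comp_sigma (S T U : NSetOb) (g : NSetHom T U) (f : NSetHom S T)
  (x : S) : g (f (sigma x)) = sigma (g (f x)).
Proof. by rewrite !nfun_sigma. Qed.

Definition NSet_comp (S T U : NSetOb) (g : NSetHom T U) (f : NSetHom S T) :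
    NSetHom S U :=
  @MkNSetHom S U (fun x => g (f x)) (NSet_comp_sigma g f).

Definition NSet : Category.
Proof.
refine (@MkCategory NSetOb NSetHom NSet_id NSet_comp _ _ _).
- by move=> X Y f; apply: NSetHom_eq.
- by move=> X Y f; apply: NSetHom_eq.
- by move=> X Y Z W h g f; apply: NSetHom_eq.
Defined.

Definition periodic (S : NSetOb) (n : nat) : set S :=
  [set x | iter n sigma x = x].

Arguments periodic S n : clear implicits.

Definition Acyclic : MorClass NSet := fun (S T : NSetOb) (f : NSetHom S T) =>
  forall n : nat, (0 < n)%N -> set_bij (periodic S n) (periodic T n) f.

Definition Surjecting : MorClass NSet :=
  fun (S T : NSetOb) (f : NSetHom S T) =>
  forall x : S, set_surj (sigma @^-1` [set x]) (sigma @^-1` [set f x]) f.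

Definition Whiskering : MorClass NSet :=
  fun (S T : NSetOb) (f : NSetHom S T) =>
  injective f /\
  forall x : T, ~ range f x -> exists n : nat, range f (iter n sigma x).

(* Main.v *)
From mathcomp Require Import all_boot.
From mathcomp Require Import boolp classical_sets functions cardinality.
Require Import Defs.
Set Implicit Arguments.
Unset Strict Implicit.
Unset Printing Implicit Defensive.
Local Open Scope classical_set_scope.

(** A lift of a Whiskering map against a Surjecting map is built by recursion on
    the number of steps a point needs to reach the image. Any f : S -> T factors
    as a Whiskering map followed by a Surjecting one through the set of triples
    (x, n, y) with sigma^n y = f x. To factor f as a cofibration followed by an
    Acyclic Surjecting map, first replace the periodic points of S by those of
    T: this is a cofibration, because periodic points lift uniquely along
    Acyclic maps, and the rest of f is Acyclic, so the first factorization
    applies to it. The remaining inclusions follow by the retract argument. *)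

(** * Finite limits and colimits *)

(* The objects of J live in a larger universe than the carriers of N-sets, so
   products and sums over J have to be indexed by a set in Set; 'I_n does not
   qualify, being declared in an unspecified universe. *)
Lemma finite_category_index (J : Category) : IsFiniteCategory J ->
  exists (I : Set) (s : I -> J) (e : J -> I)
    (c : forall j, Hom (s (e j)) j) (d : forall j, Hom j (s (e j))),
    forall j, c j ∘ d j = idm j.
Proof.
case=> [[n /card_set_bijP [g [gI ginj gsurj]]] _].
have glt j : (g j < n)%N by apply: gI.
pose I : Set := {i : nat | (i < n)%N}.
have sP (i : I) : exists j, g j = proj1_sig i.
  by case: (gsurj _ (proj2_sig i)) => j _ ji; exists j.
pose s i := projT1 (cid (sP i)).
pose e j : I := exist _ (g j) (glt j).
have se j : s (e j) = j.
  by apply: ginj; rewrite ?inE //; exact: (projT2 (cid (sP (e j)))).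
(* The equality [s (e j) = j] is only propositional; turning it into a pair of morphisms avoids
   transporting objects along it later. *)
have isoP j : exists cd : Hom (s (e j)) j * Hom j (s (e j)), cd.1 ∘ cd.2 = idm j.
  by rewrite se; exists (idm j, idm j); rewrite /= comp_idl.
pose cd j := projT1 (cid (isoP j)).
exists I, s, e, (fun j => (cd j).1), (fun j => (cd j).2) => j.
exact: (projT2 (cid (isoP j))).
Qed.

Lemma NSet_compE (X Y Z : NSet) (g : Hom Y Z) (f : Hom X Y) (x : carrier X) :
  nfun (g ∘ f) x = nfun g (nfun f x).
Proof. by []. Qed.

Lemma fmapE (J : Category) (D : Functor J NSet) (i j k : J) (g : Hom j k)
    (f : Hom i j) (x : carrier (D i)) :
  nfun (fmap D g) (nfun (fmap D f) x) = nfun (fmap D (g ∘ f)) x.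
Proof. by rewrite fmap_comp. Qed.

Lemma proj1_sig_inj (T : Type) (P : T -> Prop) : injective (@proj1_sig T P).
Proof. by case=> [x xP] [y yP]; apply: eq_exist. Qed.

(** The limit is the set of compatible families with pointwise [sigma], indexed by [I]; the
    projection to [j] moves the component at [e j] along [c j]. *)
Lemma NSet_limits : HasFiniteLimits NSet.
Proof.
move=> J D /finite_category_index [I [s [e [c [d cd]]]]].
pose P := forall i : I, carrier (D (s i)).
pose compat (x : P) :=
  forall i k (a : Hom (s i) (s k)), nfun (fmap D a) (x i) = x k.
have compat_sigma (x : P) : compat x -> compat (fun i => sigma (x i)).
  by move=> xP i k a; rewrite nfun_sigma xP.
pose L : NSet := @MkNSet {x : P | compat x}
  (fun x => exist _ _ (compat_sigma _ (proj2_sig x))).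
have psigma j (x : L) : nfun (fmap D (c j)) (proj1_sig (sigma x) (e j)) =
    sigma (nfun (fmap D (c j)) (proj1_sig x (e j))) by rewrite -nfun_sigma.
pose p j : Hom L (D j) := @MkNSetHom L (D j) _ (psigma j).
have ps i (x : L) : nfun (p (s i)) x = proj1_sig x i by exact: (proj2_sig x).
exists L, p; split=> [i j a|X q qP].
  apply: NSetHom_eq => x /=.
  (* [d j ∘ a ∘ c i] is [a] read between the indexed objects; composing it with [c j] gives back
     [a ∘ c i]. *)
  rewrite -(proj2_sig x _ _ (d j ∘ a ∘ c i)) !fmapE.
  by rewrite !comp_assoc cd comp_idl.
have uP (x : carrier X) : compat (fun i => nfun (q (s i)) x).
  by move=> i k a; rewrite -NSet_compE qP.
have usigma (x : carrier X) :
    exist compat _ (uP (sigma x)) = sigma (exist compat _ (uP x) : L).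
  by apply: eq_exist => /=; apply: functional_extensionality_dep => i;
    rewrite nfun_sigma.
exists (@MkNSetHom X L _ usigma); split=> [j|u' u'P].
  by apply: NSetHom_eq => x /=; rewrite -(qP _ _ (c j)).
apply: NSetHom_eq => x; apply: proj1_sig_inj => /=.
by apply: functional_extensionality_dep => i; rewrite -ps -u'P.
Qed.

(** Equivalence classes are taken as predicates. The chosen section [rep] lets maps out of the
    quotient be defined on representatives. *)
Lemma quotient_exists (T : Type) (R : T -> T -> Prop) :
    (forall x, R x x) -> (forall x y, R x y -> R y x) ->
    (forall x y z, R x y -> R y z -> R x z) ->
  exists (Q : Type) (pi : T -> Q) (rep : Q -> T),
    cancel rep pi /\ forall x y, pi x = pi y <-> R x y.
Proof.
move=> Rxx Rsym Rtrans.
pose Q := {A : T -> Prop | exists x, A = R x}.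
pose pi x : Q := exist _ (R x) (ex_intro _ x erefl).
have piP x y : pi x = pi y <-> R x y.
  split=> [/(congr1 (@proj1_sig _ _)) /= -> //|xy].
  apply: eq_exist; apply/funext => z; apply/propext.
  by split; apply: Rtrans => //; apply: Rsym.
have repP (A : Q) : exists x, pi x = A.
  by case: A => A [x Ax]; exists x; apply: eq_exist.
by exists Q, pi, (fun A => projT1 (cid (repP A))); split=> // A; case: cid.
Qed.

(** The colimit is the disjoint union over [I] modulo the least equivalence relation identifying [x]
    with its image under each [fmap D a]. *)
Lemma NSet_colimits : HasFiniteColimits NSet.
Proof.
move=> J D /finite_category_index [I [s [e [c [d cd]]]]].
pose T := {i : I & carrier (D (s i))}.
pose inj i (x : carrier (D (s i))) : T := existT _ i x.
pose linked (E : T -> T -> Prop) :=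
  [/\ forall x, E x x, forall x y, E x y -> E y x,
      forall x y z, E x y -> E y z -> E x z &
      forall i k (a : Hom (s i) (s k)) x, E (inj i x) (inj k (nfun (fmap D a) x))].
pose R x y := forall E, linked E -> E x y.
have [Q [pi [rep [repK piP]]]] : exists (Q : Type) (pi : T -> Q) (rep : Q -> T),
    cancel rep pi /\ forall x y, pi x = pi y <-> R x y.
  apply: quotient_exists => [x E []//|x y xy E EP|x y z xy yz E EP].
    by have [_ Esym _ _] := EP; apply: Esym; apply: xy.
  by have [_ _ Etrans _] := EP; apply: Etrans (xy E EP) (yz E EP).
have pi_linked i k (a : Hom (s i) (s k)) x :
    pi (inj i x) = pi (inj k (nfun (fmap D a) x)).
  by apply/piP => E [].
(* The kernel of such an [F] is itself a [linked] relation, hence contains [R], the intersection of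
   all of them. *)
have pi_rec (B : Type) (F : T -> B) :
    (forall i k (a : Hom (s i) (s k)) x,
      F (inj i x) = F (inj k (nfun (fmap D a) x))) ->
    forall x, F (rep (pi x)) = F x.
  move=> FP x; have /piP RP := repK (pi x).
  by apply: (RP (fun y z => F y = F z)); split=> // y z t -> ->.
pose sigT (x : T) : T := let: existT i y := x in inj i (sigma y).
have sigQ x : pi (sigT (rep (pi x))) = pi (sigT x).
  by apply: (pi_rec _ (pi \o sigT)) => i k a y /=; rewrite (pi_linked _ _ a) nfun_sigma.
pose L : NSet := @MkNSet Q (fun q => pi (sigT (rep q))).
have psigma j (x : carrier (D j)) : pi (inj _ (nfun (fmap D (d j)) (sigma x))) =
    sigma (pi (inj _ (nfun (fmap D (d j)) x)) : L).
  by rewrite /= sigQ nfun_sigma.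
pose p j : Hom (D j) L := @MkNSetHom (D j) L _ (psigma j).
have ps i x : nfun (p (s i)) x = pi (inj i x) by rewrite /= -pi_linked.
exists L, p; split=> [i j a|X q qP].
  apply: NSetHom_eq => x /=.
  by rewrite [RHS](pi_linked _ _ (d j ∘ a ∘ c i)) !fmapE -!comp_assoc cd comp_idr.
pose uT (x : T) : carrier X := nfun (q (s (projT1 x))) (projT2 x).
have upi x : uT (rep (pi x)) = uT x.
  by apply: pi_rec => i k a y; rewrite /uT /= -NSet_compE qP.
have usigma (x : L) : uT (rep (sigma x)) = sigma (uT (rep x)).
  by rewrite /= upi; case: (rep x) => i y; rewrite /uT /= nfun_sigma.
exists (@MkNSetHom L X _ usigma); split=> [j|u' u'P].
  by apply: NSetHom_eq => x /=; rewrite upi /uT /= -NSet_compE qP.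
apply: NSetHom_eq => x /=; rewrite -[x in RHS]repK.
by case: (rep x) => i y; rewrite -ps -NSet_compE u'P.
Qed.

(** * Periodic points *)

Lemma nfun_iter (S T : NSetOb) (f : NSetHom S T) n (x : S) :
  f (iter n sigma x) = iter n sigma (f x).
Proof. by elim: n => //= n <-; rewrite nfun_sigma. Qed.

Lemma periodic_nfun (S T : NSetOb) (f : NSetHom S T) n (x : S) :
  periodic S n x -> periodic T n (f x).
Proof. by rewrite /periodic /= -nfun_iter => ->. Qed.

Lemma periodic_sigma (S : NSetOb) n (x : S) :
  periodic S n x -> periodic S n (sigma x).
Proof. by rewrite /periodic /= -iterSr iterS => ->. Qed.

Lemma periodicM (S : NSetOb) n m (x : S) :
  periodic S n x -> periodic S (m * n) x.
Proof. by rewrite /periodic /= => xn; elim: m => //= m IH; rewrite mulSn iterD IH. Qed.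

Lemma AcyclicP (S T : NSetOb) (f : NSetHom S T) :
  Acyclic f <-> forall n, (0 < n)%N ->
    (forall x y, periodic S n x -> periodic S n y -> f x = f y -> x = y) /\
    (forall y, periodic T n y -> exists2 x, periodic S n x & f x = y).
Proof.
split=> fP n n0; have := fP n n0.
  case=> _ finj fsurj; split=> [x y xn yn|y yn]; last exact: fsurj.
  by apply: finj; rewrite inE.
case=> finj fsurj; split=> [x|x y|y]; first exact: periodic_nfun.
  by rewrite !inE; apply: finj.
exact: fsurj.
Qed.

Lemma Acyclic_2of3 : TwoOutOfThree Acyclic.
Proof.
move=> X Y Z a b; split=> /AcyclicP P /AcyclicP Q; apply/AcyclicP => n n0.
- have [ai as_] := P n n0; have [bi bs] := Q n n0; split.
    by move=> x y xn yn /ai xy; apply: bi => //; apply: xy; apply: periodic_nfun.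
  by move=> z /as_ [y /bs [x xn <-] <-]; exists x.
- have [ai as_] := P n n0; have [abi abs] := Q n n0; split.
    by move=> x y xn yn xy; apply: abi => //=; rewrite xy.
  move=> y yn; have [x xn xy] := abs _ (periodic_nfun a yn).
  by exists x => //; apply: ai => //; apply: periodic_nfun.
- have [bi bs] := P n n0; have [abi abs] := Q n n0; split.
    by move=> _ _ /bs [x xn <-] /bs [y yn <-] xy; rewrite (abi x y).
  by move=> z /abs [x xn <-]; exists (b x) => //; apply: periodic_nfun.
Qed.

Definition recurrent (S : NSetOb) (x : S) := exists2 n, (0 < n)%N & periodic S n x.

Lemma recurrent_nfun (S T : NSetOb) (f : NSetHom S T) (x : S) :
  recurrent x -> recurrent (f x).
Proof. by case=> n n0 xn; exists n => //; apply: periodic_nfun. Qed.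

Lemma recurrent_sigma (S : NSetOb) (x : S) : recurrent x -> recurrent (sigma x).
Proof. by case=> n n0 xn; exists n => //; apply: periodic_sigma. Qed.

(** Two points of periods [n] and [m] share the period [m * n], where acyclicity compares them. *)
Lemma Acyclic_recurrent_inj (S T : NSetOb) (f : NSetHom S T) (x y : S) :
  Acyclic f -> recurrent x -> recurrent y -> f x = f y -> x = y.
Proof.
move=> /AcyclicP fP [n n0 xn] [m m0 ym].
have [|finj _] := fP (m * n)%N; first by rewrite muln_gt0 m0.
by apply: finj; [|rewrite mulnC]; apply: periodicM.
Qed.

Lemma Acyclic_recurrent_surj (S T : NSetOb) (f : NSetHom S T) (y : T) :
  Acyclic f -> recurrent y -> exists2 x, recurrent x & f x = y.
Proof.
move=> /AcyclicP fP [n n0 yn]; have [x xn xy] := (fP n n0).2 y yn.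
by exists x => //; exists n.
Qed.

(** * Whiskering and Surjecting maps *)

Lemma Whiskering_reach (S T : NSetOb) (f : NSetHom S T) (y : T) :
  Whiskering f -> exists n x, f x = iter n sigma y.
Proof.
case=> _ /(_ y) fP; have [[x _ xy]|/fP [n [x _ xy]]] := pselect (range f y).
  by exists 0%N, x.
by exists n, x.
Qed.

(** A point [y] of period [n] enters the image after some [m] steps; since the image is stable,
    [m * n - m] further steps bring it back to [y] inside the image. *)
Lemma Whiskering_Acyclic (S T : NSetOb) (f : NSetHom S T) :
  Whiskering f -> Acyclic f.
Proof.
move=> fW; have [finj _] := fW; apply/AcyclicP => n n0; split=> [x y _ _|y yn].
  exact: finj.
have [m [x xy]] := Whiskering_reach y fW.
have fx : f (iter (m * n - m) sigma x) = y.
  rewrite nfun_iter xy -iterD subnK ?leq_pmulr //.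
  exact: periodicM.
exists (iter (m * n - m) sigma x) => //.
by apply: finj; rewrite nfun_iter fx.
Qed.

Lemma SurjectingP (S T : NSetOb) (f : NSetHom S T) :
  Surjecting f <-> forall x y, sigma y = f x -> exists2 x', f x' = y & sigma x' = x.
Proof.
split=> [fS x y yx|fS x y /= yx].
  by have [x' /= x'x x'y] := fS x y yx; exists x'.
by have [x' x'y x'x] := fS x y yx; exists x'.
Qed.

Lemma Whiskering_Surjecting_Lifts (A B X Y : NSet) (l : Hom A B) (r : Hom X Y) :
  Whiskering l -> Surjecting r -> Lifts l r.
Proof.
move=> lW /SurjectingP rS u v ruvl.
have rul a : nfun r (nfun u a) = nfun v (nfun l a) by rewrite -!NSet_compE ruvl.
have linj : injective (nfun l) := lW.1.
(* The condition sits under the existential so that [step] is total; [x] is the default when it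
   fails. *)
have stepP (b : carrier B) (x : carrier X) :
    exists x', nfun r x = sigma (nfun v b) ->
      nfun r x' = nfun v b /\ sigma x' = x.
  have [xb|nxb] := pselect (nfun r x = sigma (nfun v b)); last by exists x => /nxb.
  by have [x' ? ?] := rS x _ (esym xb); exists x'.
pose step b x := projT1 (cid (stepP b x)).
have stepE b x : nfun r x = sigma (nfun v b) ->
    nfun r (step b x) = nfun v b /\ sigma (step b x) = x.
  exact: (projT2 (cid (stepP b x))).
(* [N b] will be the least number of steps from [b] to the image of [l]; minimality makes it drop by
   exactly one along [sigma]. *)
have reach b : exists n, `[< exists a, nfun l a = iter n sigma b >].
  by have [n bn] := Whiskering_reach b lW; exists n; apply/asboolP.
pose N b := ex_minn (reach b).
have NP b : exists a, nfun l a = iter (N b) sigma b.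
  by rewrite /N; case: ex_minnP => n /asboolP.
have Nmin b n a : nfun l a = iter n sigma b -> (N b <= n)%N.
  by rewrite /N; case: ex_minnP => m _ min an; apply: min; apply/asboolP; exists a.
have Nsigma b n : N b = n.+1 -> N (sigma b) = n.
  move=> Nb; apply/eqP; rewrite eqn_leq; apply/andP; split.
    by have [a] := NP b; rewrite Nb iterSr; apply: Nmin.
  by have [a] := NP (sigma b); rewrite -iterSr => /Nmin; rewrite Nb.
pose base b := projT1 (cid (NP b)).
have baseP b : nfun l (base b) = iter (N b) sigma b.
  exact: (projT2 (cid (NP b))).
pose fix g (n : nat) (b : carrier B) {struct n} : carrier X :=
  if n is m.+1 then step b (g m (sigma b)) else nfun u (base b).
pose h b := g (N b) b.
(* At [0], both [b] and [sigma b] lie in the image of [l], where [h] is [u] read through the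
   injection. Otherwise [h b] is a chosen [sigma]-preimage of [h (sigma b)] over [v b], which gives
   both claims at once. *)
have hP n b : N b = n -> nfun r (h b) = nfun v b /\ sigma (h b) = h (sigma b).
  elim: n b => [|n IH] b Nb.
    have := baseP b; rewrite Nb /= => bb.
    have lbs : nfun l (sigma (base b)) = sigma b by rewrite nfun_sigma bb.
    have Ns : N (sigma b) = 0%N.
      by apply/eqP; rewrite -leqn0; apply: (@Nmin _ 0%N _ lbs).
    have bs : base (sigma b) = sigma (base b).
      by apply: linj; rewrite baseP Ns.
    by rewrite /h Nb Ns /= rul bb bs nfun_sigma.
  have [rh _] := IH _ (Nsigma _ _ Nb).
  have -> : h b = step b (h (sigma b)) by rewrite /h Nb (Nsigma _ _ Nb).
  by apply: stepE; rewrite rh nfun_sigma.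
exists (@MkNSetHom B X h (fun b => esym (hP _ b erefl).2)).
split; apply: NSetHom_eq => x /=; last exact: (hP _ x erefl).1.
have N0 : N (nfun l x) = 0%N.
  by apply/eqP; rewrite -leqn0; apply: (@Nmin _ 0%N x).
by rewrite /h N0 /=; congr (nfun u _); apply: linj; rewrite baseP N0.
Qed.

(** In a triple [(x, n, y)], [n] counts down the steps left before [y] meets [f x]; at [0] the
    triple is in the image of [l]. A preimage of [y] gives a preimage of the triple with counter
    [n.+1], so [r] is Surjecting. *)
Lemma Whiskering_factor (X Y : NSet) (f : Hom X Y) :
  exists (Z : NSet) (l : Hom X Z) (r : Hom Z Y),
    [/\ Whiskering l, Surjecting r & f = r ∘ l].
Proof.
pose T := (carrier X * nat * carrier Y)%type.
pose P (t : T) := iter t.1.2 sigma t.2 = nfun f t.1.1.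
pose sigT (t : T) : T := let: (x, n, y) := t in
  (if n is 0 then sigma x else x, n.-1, sigma y).
have sigP t : P t -> P (sigT t).
  case: t => [[x [|n]] y]; rewrite /P /=; first by rewrite nfun_sigma => ->.
  by rewrite -iterSr.
pose Z : NSet := @MkNSet {t : T | P t}
  (fun t => exist _ _ (sigP _ (proj2_sig t))).
have lsigma (x : carrier X) :
    (exist P (sigma x, 0%N, nfun f (sigma x)) erefl : Z) =
    sigma (exist P (x, 0%N, nfun f x) erefl : Z).
  by apply: eq_exist => /=; rewrite nfun_sigma.
pose l : Hom X Z := @MkNSetHom X Z (fun x => exist P (x, 0%N, nfun f x) erefl) lsigma.
have rsigma (t : Z) : (proj1_sig (sigma t)).2 = sigma (proj1_sig t).2.
  by case: t => [[[x n] y] ?].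
pose r : Hom Z Y := @MkNSetHom Z Y (fun t => (proj1_sig t).2) rsigma.
exists Z, l, r; split; last exact: NSetHom_eq.
- split=> [x y [] //|[[[x n] y] yP] _]; exists n.
  elim: n y yP => [|n IH] y yP.
    by exists x => //; apply: eq_exist; rewrite -[nfun f x]yP.
  have yP' : P (x, n, sigma y) by rewrite /P /= -iterSr.
  have [x' _ x'E] := IH _ yP'; exists x' => //; rewrite x'E iterSr.
  by congr (iter _ _ _); apply: eq_exist.
- apply/SurjectingP => [[[[x n] y'] yP]] y /= yy'.
  have tP : P (x, n.+1, y) by rewrite /P iterSr yy'.
  exists (exist P (x, n.+1, y) tP) => //.
  by apply: eq_exist => /=; rewrite yy'.
Qed.

(** * Factorization through periodic points *)

(** [Z] consists of the non-recurrent points of [X] and the recurrent points of [Y]; [k] applies [f]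
    exactly to the recurrent points. *)
Lemma periodic_factor (X Y : NSet) (f : Hom X Y) :
  exists (Z : NSet) (k : Hom X Z) (g : Hom Z Y),
    [/\ llp (mcap Acyclic Surjecting) k, Acyclic g & f = g ∘ k].
Proof.
pose P (z : carrier X + carrier Y) :=
  match z with inl x => ~ recurrent x | inr y => recurrent y end.
pose Z := {z | P z}.
pose k (x : carrier X) : Z :=
  match pselect (recurrent x) with
  | left rx => exist P (inr _) (recurrent_nfun f rx)
  | right nx => exist P (inl x) nx
  end.
have kl x (nx : P (inl x)) : k x = exist P (inl x) nx.
  by rewrite /k; case: pselect => // nx'; apply: eq_exist.
have kr x (rx : P (inr (nfun f x))) : recurrent x -> k x = exist P (inr (nfun f x)) rx.
  by rewrite /k; case: pselect => // rx' _; apply: eq_exist.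
pose sigZ (z : Z) : Z :=
  match z with
  | exist (inl x) _ => k (sigma x)
  | exist (inr y) yP => exist P (inr (sigma y)) (recurrent_sigma yP)
  end.
pose ZZ : NSet := @MkNSet Z sigZ.
have ksigma (x : carrier X) : k (sigma x) = sigma (k x : ZZ).
  rewrite {2}/k; case: pselect => //= rx.
  have rs := recurrent_sigma rx.
  rewrite (kr _ (recurrent_nfun f rs) rs).
  by apply: eq_exist; rewrite nfun_sigma.
pose g (z : Z) : carrier Y :=
  match proj1_sig z with inl x => nfun f x | inr y => y end.
have gk x : g (k x) = nfun f x by rewrite /k; case: pselect.
have gsigma (z : ZZ) : g (sigma z) = sigma (g z).
  by case: z => [[x|y] zP] //=; rewrite gk nfun_sigma.
pose kh : Hom X ZZ := @MkNSetHom X ZZ k ksigma.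
pose gh : Hom ZZ Y := @MkNSetHom ZZ Y g gsigma.
have iter_inr m y (yP : P (inr y)) :
    proj1_sig (iter m sigma (exist P (inr y) yP : ZZ)) = inr (iter m sigma y).
  by elim: m => //= m; case: (iter m _ (exist _ _ _)) => [[x|y'] ?] //= [->].
have periodic_inr n y (yP : P (inr y)) :
    periodic Y n y -> periodic ZZ n (exist P (inr y) yP).
  by move=> yn; apply: proj1_sig_inj; rewrite iter_inr /= yn.
exists ZZ, kh, gh; split; last by apply: NSetHom_eq => x; rewrite /= gk.
- move=> E D r [rA _] u v ruvk.
  have ruk x : nfun r (nfun u x) = nfun v (k x).
    by rewrite -[LHS]NSet_compE ruvk.
  have zr y (yP : P (inr y)) : recurrent (exist P (inr y) yP : ZZ).
    by have [n n0 yn] := yP; exists n => //; apply: periodic_inr.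
  (* On [inl] the lift is forced to be [u]; on [inr] it is the recurrent point above [v z], unique
     because [r] is Acyclic. This uniqueness yields both [hk] and [hsigma]. *)
  have liftP (z : ZZ) : exists e,
      match proj1_sig z with inl x => e = nfun u x
      | inr _ => recurrent e /\ nfun r e = nfun v z end.
    case: z => [[x|y] zP] /=; first by exists (nfun u x).
    have [e er ee] := Acyclic_recurrent_surj rA (recurrent_nfun v (zr y zP)).
    by exists e.
  pose h z := projT1 (cid (liftP z)).
  have hl x (nx : P (inl x)) : h (exist P (inl x) nx) = nfun u x.
    exact: (projT2 (cid (liftP (exist P (inl x) nx)))).
  have hr y (yP : P (inr y)) : recurrent (h (exist P (inr y) yP)) /\
      nfun r (h (exist P (inr y) yP)) = nfun v (exist P (inr y) yP).
    exact: (projT2 (cid (liftP (exist P (inr y) yP)))).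
  have hk x : h (k x) = nfun u x.
    have [rx|nx] := pselect (recurrent x); last by rewrite (kl _ nx) hl.
    have rfx := recurrent_nfun f rx.
    rewrite (kr _ rfx rx); have [rh rhE] := hr _ rfx.
    apply: (Acyclic_recurrent_inj rA rh); first exact: recurrent_nfun.
    by rewrite rhE ruk (kr _ rfx rx).
  have hsigma (z : ZZ) : h (sigma z) = sigma (h z).
    case: z => [[x|y] zP] /=; first by rewrite hk hl nfun_sigma.
    have [rs rsE] := hr _ (recurrent_sigma zP); have [ry ryE] := hr _ zP.
    apply: (Acyclic_recurrent_inj rA) => //; first exact: recurrent_sigma.
    by rewrite rsE nfun_sigma ryE -nfun_sigma.
  exists (@MkNSetHom ZZ E h hsigma); split; apply: NSetHom_eq => //= z.
  case: z => [[x|y] zP]; last by case: (hr _ zP).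
  by rewrite hl ruk (kl _ zP).
(* An orbit never passes from [inr] back to [inl], so a periodic [inl x] would make [x] recurrent in
   [X]. Hence the periodic points of [Z] are those of [Y]. *)
- have iter_inl m (z : ZZ) x : proj1_sig (iter m sigma z) = inl x ->
      exists2 x', proj1_sig z = inl x' & x = iter m sigma x'.
    elim: m x => [|m IH] x /=; first by exists x.
    case E: (iter m sigma z) => [[x'|y'] zP] //= kx.
    have [|x'' zx x'E] := IH x'; first by rewrite E.
    exists x'' => //; rewrite -x'E; move: kx; rewrite /k.
    by case: pselect => //= _ [->].
  have perZ n (z : ZZ) : (0 < n)%N -> periodic ZZ n z -> exists y, proj1_sig z = inr y.
    move=> n0; case: z => [[x|y] zP] zn; last by exists y.
    have [|x' [<-] xE] := iter_inl n (exist P (inl x) zP) x; first by rewrite zn.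
    by case: (zP); exists n.
  apply/AcyclicP => n n0; split.
    move=> z z' /(perZ _ _ n0) [y zy] /(perZ _ _ n0) [y' zy'].
    move: z z' zy zy' => [z zP] [z' zP'] /= ? ?; subst z z'.
    by rewrite /g /= => yy'; apply: eq_exist; rewrite yy'.
  move=> y yn; have yP : P (inr y) by exists n.
  by exists (exist P (inr y) yP) => //; apply: periodic_inr.
Qed.

(** * Retract arguments *)


(** Filling the square with top [idm X] and bottom [r] makes [f] a retract of [r]; [llp_retract] is
    the dual. *)
Lemma rlp_retract (C : Category) (X Y Z : C) (f : Hom X Y) (l : Hom X Z)
    (r : Hom Z Y) : f = r ∘ l -> Lifts l f ->
  exists2 h : Hom Z X, h ∘ l = idm X & f ∘ h = r.
Proof.
move=> frl lf; have [|h [hl fh]] := lf (idm X) r; first by rewrite comp_idr.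
by exists h.
Qed.

Lemma llp_retract (C : Category) (X Y Z : C) (f : Hom X Y) (l : Hom X Z)
    (r : Hom Z Y) : f = r ∘ l -> Lifts f r ->
  exists2 h : Hom Y Z, h ∘ f = l & r ∘ h = idm Y.
Proof.
move=> frl fr; have [|h [hf rh]] := fr l (idm Y); first by rewrite comp_idl.
by exists h.
Qed.

Section Retract.
Variables (X Y Z : NSet) (f : Hom X Y) (l : Hom X Z) (r : Hom Z Y).
Hypothesis frl : f = r ∘ l.

Let frlE x : nfun f x = nfun r (nfun l x).
Proof. by rewrite frl. Qed.

Lemma Surjecting_retract : Lifts l f -> Surjecting r -> Surjecting f.
Proof.
move=> /(rlp_retract frl) [h hl fh] /SurjectingP rS; apply/SurjectingP => x y yx.
have hlE t : nfun h (nfun l t) = t by rewrite -NSet_compE hl.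
have fhE t : nfun f (nfun h t) = nfun r t by rewrite -NSet_compE fh.
have [|z rz sz] := rS (nfun l x) y; first by rewrite -frlE.
by exists (nfun h z); rewrite ?fhE // -nfun_sigma sz hlE.
Qed.

Lemma Acyclic_retract : Lifts l f -> Acyclic r -> Acyclic f.
Proof.
move=> /(rlp_retract frl) [h hl fh] /AcyclicP rA; apply/AcyclicP => n n0.
have hlE t : nfun h (nfun l t) = t by rewrite -NSet_compE hl.
have fhE t : nfun f (nfun h t) = nfun r t by rewrite -NSet_compE fh.
have [rinj rsurj] := rA n n0; split=> [x y xn yn|y /rsurj [z zn zy]].
  rewrite !frlE => xy; rewrite -(hlE x) -(hlE y); congr (nfun h _).
  by apply: rinj => //; apply: periodic_nfun.
by exists (nfun h z); rewrite ?fhE //; apply: periodic_nfun.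
Qed.

Lemma Whiskering_retract : Lifts f r -> Whiskering l -> Whiskering f.
Proof.
move=> /(llp_retract frl) [h hf rh] lW.
have hfE t : nfun h (nfun f t) = nfun l t by rewrite -NSet_compE hf.
have rhE t : nfun r (nfun h t) = t by rewrite -NSet_compE rh.
split=> [x y xy|y _]; first by apply: lW.1; rewrite -!hfE xy.
(* The path from [h y] to the image of [l] is carried by [r] to a path from [y] to the image of
   [f]. *)
have [n [x xn]] := Whiskering_reach (nfun h y) lW; exists n, x => //.
by rewrite frlE xn nfun_iter rhE.
Qed.

End Retract.

(** * The two weak factorization systems *)

Lemma Whiskering_cofibration (A B : NSet) (l : Hom A B) :
  Whiskering l -> llp (mcap Acyclic Surjecting) l.
Proof. by move=> lW X Y r [_ rS]; apply: Whiskering_Surjecting_Lifts. Qed.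

Lemma llp_comp (C : Category) (P : MorClass C) (X Y Z : C) (g : Hom Y Z)
    (f : Hom X Y) : llp P f -> llp P g -> llp P (g ∘ f).
Proof.
move=> fP gP E D r rP u v ruv.
have [|h [hf rh]] := fP _ _ r rP u (v ∘ g); first by rewrite -comp_assoc.
have [k [kg rk]] := gP _ _ r rP h v rh.
by exists k; rewrite comp_assoc kg.
Qed.

(** When [f = r ∘ l] with [l] Whiskering and [f] Acyclic, two-out-of-three makes [r] Acyclic, so a
    cofibration [f] lifts against [r] and is a retract of [l]. *)
Lemma acyclic_cofibrationE :
  mceq (mcap (llp (mcap Acyclic Surjecting)) Acyclic) Whiskering.
Proof.
move=> X Y f; split=> [[fC fA]|fW]; last first.
  by split; [apply: Whiskering_cofibration | apply: Whiskering_Acyclic].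
have [Z [l [r [lW rS frl]]]] := Whiskering_factor f.
have [_ _ rA] := Acyclic_2of3 r l; rewrite -frl in rA.
apply: (Whiskering_retract frl _ lW); apply: fC; split=> //.
exact: rA (Whiskering_Acyclic lW) fA.
Qed.

Lemma Whiskering_Surjecting_WFS :
  IsWFS (mcap (llp (mcap Acyclic Surjecting)) Acyclic) Surjecting.
Proof.
split=> [X Y f|X Y f|X Y f].
- split=> [fR|fS A B l /acyclic_cofibrationE lW]; last first.
    exact: Whiskering_Surjecting_Lifts.
  have [Z [l [r [lW rS frl]]]] := Whiskering_factor f.
  by apply: (Surjecting_retract frl) rS; apply/fR/acyclic_cofibrationE.
- split=> [/acyclic_cofibrationE fW A B r|fL].
    exact: Whiskering_Surjecting_Lifts.
  have [Z [l [r [lW rS frl]]]] := Whiskering_factor f.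
  by apply/acyclic_cofibrationE/(Whiskering_retract frl) => //; apply: fL.
- have [Z [l [r [lW rS frl]]]] := Whiskering_factor f.
  by exists Z, l, r; split=> //; apply/acyclic_cofibrationE.
Qed.

(** Once the periodic points are corrected, the remaining factor [g] is Acyclic, and
    two-out-of-three passes this to the Surjecting part of its factorization. *)
Lemma cofibration_factor (X Y : NSet) (f : Hom X Y) :
  exists (Z : NSet) (l : Hom X Z) (r : Hom Z Y),
    [/\ llp (mcap Acyclic Surjecting) l, mcap Acyclic Surjecting r & f = r ∘ l].
Proof.
have [Z' [k [g [kC gA ->]]]] := periodic_factor f.
have [Z [l [r [lW rS grl]]]] := Whiskering_factor g.
exists Z, (l ∘ k), r; split; last by rewrite grl comp_assoc.
  by apply: llp_comp => //; apply: Whiskering_cofibration.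
split=> //; have [_ _] := Acyclic_2of3 r l; rewrite -grl; apply=> //.
exact: Whiskering_Acyclic.
Qed.

Lemma cofibration_WFS :
  IsWFS (llp (mcap Acyclic Surjecting)) (mcap Acyclic Surjecting).
Proof.
split=> [X Y f|X Y f|X Y f]; [|by []|exact: cofibration_factor].
split=> [fR|fAS A B l]; last by apply.
have [Z [l [r [lC [rA rS] frl]]]] := cofibration_factor f.
have lf := fR _ _ l lC.
by split; [apply: (Acyclic_retract frl) | apply: (Surjecting_retract frl)].
Qed.

Theorem mainTheorem6 :
  IsModelStructure (llp (mcap Acyclic Surjecting)) Acyclic Surjecting /\
  mceq (mcap (llp (mcap Acyclic Surjecting)) Acyclic) Whiskering.
Proof.
split; last exact: acyclic_cofibrationE.
split; [exact: NSet_limits | exact: NSet_colimits | exact: Acyclic_2of3 |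
        exact: Whiskering_Surjecting_WFS | exact: cofibration_WFS].
Qed.
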